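(* Let $G_1,G_2,G$ be simple, simply connected complex Lie groups with Lie algebras $\mathfrak g_1,\mathfrak g_2,\mathfrak g$, let $\phi:G_1\times G_2\to G$ be a homomorphism, and denote also by $\phi:\mathfrak g_1\oplus\mathfrak g_2\to\mathfrak g$ the induced map of Lie algebras. Let $\mathfrak h_1,\mathfrak h_2,\mathfrak h$ be Cartan subalgebras of $\mathfrak g_1,\mathfrak g_2,\mathfrak g$ such that $\phi(\mathfrak h_1\oplus\mathfrak h_2)\subset\mathfrak h$. Let $P_1^\vee$ and $P^\vee$ be the coweight lattices of $(\mathfrak g_1,\mathfrak h_1)$ and $(\mathfrak g,\mathfrak h)$. Let $z_1,\dots,z_n$ be pairwise distinct complex numbers, and let $\vec\mu=(\mu_1,\dots,\mu_n)\in(P_1^\vee)^n$ with $\sum_{i=1}^n\mu_i=0$ be such that $\vec{\tilde\mu}=(\phi(\mu_1),\dots,\phi(\mu_n))\in(P^\vee)^n$. Then for every $s\in\{1,\dots,n\}$, $$\sigma_{\vec{\tilde\mu},s}\circ\widehat\phi=\widehat\phi\circ(\sigma_{\vec\mu,s}\oplus\mathrm{id})$$ as maps $\widehat{\mathfrak g}_1\oplus\widehat{\mathfrak g}_2\to\widehat{\mathfrak g}$.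
   Context: For a simple complex Lie algebra $\mathfrak a$ with Cartan subalgebra $\mathfrak t$ and root set $\Delta$, the coweight lattice is $\{x\in\mathfrak t:\alpha(x)\in\mathbb Z\ \forall\alpha\in\Delta\}$, and $\langle\,,\,\rangle_{\mathfrak a}$ is the Cartan–Killing form normalized so that the longest root has squared length $2$. The affine Lie algebra is $\widehat{\mathfrak a}=\mathfrak a\otimes\mathbb C((\xi))\oplus\mathbb Cc$, with $c$ central and $[X\otimes f,Y\otimes g]=[X,Y]\otimes fg+\langle X,Y\rangle_{\mathfrak a}\operatorname{Res}_{\xi=0}(g\,df)\,c$. Write $\phi_i=\phi|_{\mathfrak g_i}$. The Dynkin multi-index $(\ell_1,\ell_2)$ of $\phi$ is defined by $\langle\phi_i(X),\phi_i(Y)\rangle_{\mathfrak g}=\ell_i\langle X,Y\rangle_{\mathfrak g_i}$ for $X,Y\in\mathfrak g_i$. The extension $\widehat\phi:\widehat{\mathfrak g}_1\oplus\widehat{\mathfrak g}_2\to\widehat{\mathfrak g}$ is $\widehat\phi=\widehat\phi_1+\widehat\phi_2$ with $\widehat\phi_i(X\otimes f+a\,c)=\phi_i(X)\otimes f+a\,\ell_i\,c$ for $X\in\mathfrak g_i$, $f\in\mathbb C((\xi))$, $a\in\mathbb C$. Multi-shift automorphism: for a simple complex Lie algebra $\mathfrak a$ with Cartan subalgebra $\mathfrak t$, pairwise distinct $z_1,\dots,z_n\in\mathbb C$, a tuple $\vec\nu=(\nu_1,\dots,\nu_n)$ of coweights of $(\mathfrak a,\mathfrak t)$ with $\sum_i\nu_i=0$,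 and $t\in\{1,\dots,n\}$, the automorphism $\sigma_{\vec\nu,t}=\sigma_{\vec\nu,t}(\vec z)$ of $\widehat{\mathfrak a}$ is given by $$\sigma_{\vec\nu,t}(c)=c,\qquad \sigma_{\vec\nu,t}(h\otimes f)=h\otimes f+\Big(\sum_{s=1}^n\langle h,\nu_s\rangle_{\mathfrak a}\operatorname{Res}_{\xi=0}(\varphi_{t,s}f\,d\xi)\Big)c,\qquad \sigma_{\vec\nu,t}(X_\alpha\otimes f)=X_\alpha\otimes f\prod_{s=1}^n\varphi_{t,s}^{-\alpha(\nu_s)},$$ for $h\in\mathfrak t$, $X_\alpha$ in the root space of $\alpha$ and $f\in\mathbb C((\xi))$, where $\varphi_{t,s}(\xi)=(\xi+(z_t-z_s))^{-1}$, expanded in $\mathbb C((\xi))$. *)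

(* Defs.v *)
From HB Require Import structures.
From mathcomp Require Import all_boot all_order all_algebra.
From mathcomp Require Import boolp classical_sets functions fsbigop reals complex.
From mathcomp Require Import zify ring.

Set Implicit Arguments.
Unset Strict Implicit.
Unset Printing Implicit Defensive.

Import Order.TTheory GRing.Theory Num.Theory.

Local Open Scope ring_scope.


(* V((xi)): x n is the coefficient of xi^n. *)
Definition bounded_below (V : zmodType) : {pred int -> V} :=
  fun x => `[< exists a : int, forall n, n < a -> x n = 0 >].

Record laurent (V : zmodType) := Laurent {
  lcoef :> int -> V;
  _ : lcoef \in @bounded_below V }.

HB.instance Definition _ (V : zmodType) := [isSub for @lcoef V].
HB.instance Definition _ (V : zmodType) := [Choice of laurent V by <:].

Lemma bounded_belowP (V : zmodType) (x : int -> V) :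
  reflect (exists a : int, forall n, n < a -> x n = 0) (x \in @bounded_below V).
Proof. exact: asboolP. Qed.

Lemma bounded_below_zmod (V : zmodType) : zmod_closed (@bounded_below V).
Proof.
split; first by apply/bounded_belowP; exists 0.
move=> x y /bounded_belowP[a xa] /bounded_belowP[b yb].
apply/bounded_belowP; exists (Num.min a b) => n.
by rewrite lt_min => /andP[na nb]; rewrite !fctE xa// yb// subr0.
Qed.

HB.instance Definition _ (V : zmodType) :=
  GRing.isZmodClosed.Build (int -> V) (@bounded_below V)
    (@bounded_below_zmod V).
HB.instance Definition _ (V : zmodType) :=
  [SubChoice_isSubZmodule of laurent V by <:].

Lemma bounded_below_scale (K : pzRingType) (V : lmodType K) :
  GRing.scaler_closed (@bounded_below V).
Proof.
move=> c x /bounded_belowP[a xa]; apply/bounded_belowP; exists a => n na.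
by rewrite fctE xa// scaler0.
Qed.

HB.instance Definition _ (K : pzRingType) (V : lmodType K) :=
  GRing.isScaleClosed.Build K (int -> V) (@bounded_below V)
    (@bounded_below_scale K V).
HB.instance Definition _ (K : pzRingType) (V : lmodType K) :=
  [SubZmodule_isSubLmodule of laurent V by <:].

Section LaurentTheory.
Variable V : zmodType.
Implicit Types x y : laurent V.

Lemma laurentP x y : (forall n, x n = y n) <-> x = y.
Proof. by split=> [xy|->//]; apply: val_inj; apply: funext. Qed.

Lemma laurent_bound x : exists a : int, forall n, n < a -> x n = 0.
Proof. exact/bounded_belowP/(valP x). Qed.

Lemma lcoefD x y n : (x + y) n = x n + y n. Proof. by []. Qed.
Lemma lcoefN x n : (- x) n = - x n. Proof. by []. Qed.
Lemma lcoefB x y n : (x - y) n = x n - y n. Proof. by []. Qed.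
Lemma lcoef0 n : (0 : laurent V) n = 0. Proof. by []. Qed.
Lemma lcoef_sum I (r : seq I) P (F : I -> laurent V) n :
  (\sum_(i <- r | P i) F i) n = \sum_(i <- r | P i) F i n.
Proof. by elim/big_rec2: _ => // i y x _ <-. Qed.

End LaurentTheory.

Lemma lcoefZ (K : pzRingType) (V : lmodType K) (c : K) (x : laurent V) n :
  (c *: x) n = c *: x n.
Proof. by []. Qed.

Section Convolution.
Variables (U V W : zmodType) (op : U -> V -> W).
Hypotheses (op0l : forall v, op 0 v = 0) (op0r : forall u, op u 0 = 0).

Lemma conv_window (x : int -> U) (y : int -> V) (a b n : int) :
    (forall i, i < a -> x i = 0) -> (forall i, i < b -> y i = 0) ->
  \sum_(i \in [set: int]%classic) op (x i) (y (n - i)) =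
  if n < a + b then 0 else
  \sum_(0 <= k < (absz (n - (a + b))%R).+1) op (x (a + k%:Z)) (y (n - (a + k%:Z))).
Proof.
move=> xa yb; case: ltP => [nab|abn].
  apply: fsbig1 => i _; case: (ltP i a) => ia; first by rewrite xa.
  by rewrite [y _]yb ?op0r//; lia.
set m := (absz _).+1.
rewrite -(fsbig_widen [set` [seq a + k%:Z | k <- iota 0 m]] setT)//.
  rewrite -fsbig_seq; last first.
    by rewrite map_inj_uniq ?iota_uniq// => i j; lia.
  by rewrite big_map /index_iota subn0.
move=> i [_ /= Ni] /=; case: (ltP i a) => ia; first by rewrite xa.
rewrite [y _]yb ?op0r//; apply: contra_notT Ni; rewrite -leNgt => bi.
suff: i \in [seq a + k%:Z | k <- iota 0 m] by [].
by apply/mapP; exists (absz (i - a)%R); rewrite ?mem_iota; lia.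
Qed.

(* Boundedness of x and y makes the support of this sum finite. *)
Fact lconv_subproof (x : laurent U) (y : laurent V) :
  (fun n : int => \sum_(i \in [set: int]%classic) op (x i) (y (n - i)))
    \in @bounded_below W.
Proof.
have [[a xa] [b yb]] := (laurent_bound x, laurent_bound y).
apply/bounded_belowP; exists (a + b) => n nab.
by rewrite (conv_window _ xa yb) nab.
Qed.

Definition lconv (x : laurent U) (y : laurent V) : laurent W :=
  Laurent (lconv_subproof x y).

Lemma lconvE (x : laurent U) (y : laurent V) (a b : int) (k : nat) :
    (forall i, i < a -> x i = 0) -> (forall i, i < b -> y i = 0) ->
  lconv x y (a + b + k%:Z) =
  \sum_(i < k.+1) op (x (a + i%:Z)) (y (b + (k - i)%N%:Z)).
Proof.
move=> xa yb; rewrite /lconv /= (conv_window _ xa yb).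
have -> : (a + b + k%:Z < a + b) = false by lia.
have -> : absz (a + b + k%:Z - (a + b))%R = k by lia.
rewrite big_mkord; apply: eq_bigr => i _; congr (op _ (y _)).
by have := ltn_ord i; lia.
Qed.

Lemma lconv_lt (x : laurent U) (y : laurent V) (a b n : int) :
    (forall i, i < a -> x i = 0) -> (forall i, i < b -> y i = 0) ->
  n < a + b -> lconv x y n = 0.
Proof. by move=> xa yb nab; rewrite /lconv /= (conv_window _ xa yb) nab. Qed.

End Convolution.

Fact lmonom_subproof (V : zmodType) (m : int) (v : V) :
  (fun n : int => if n == m then v else 0) \in @bounded_below V.
Proof.
by apply/bounded_belowP; exists m => n nm; case: eqP => // nE; lia.
Qed.

Definition lmonom (V : zmodType) (m : int) (v : V) : laurent V :=
  Laurent (lmonom_subproof m v).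

Section LaurentField.
Variable K : fieldType.
Implicit Types x y z : laurent K.

Definition lmul : laurent K -> laurent K -> laurent K :=
  lconv (@mul0r K) (@mulr0 K).

Let lmul_lt x y (a b n : int) :
    (forall i, i < a -> x i = 0) -> (forall i, i < b -> y i = 0) ->
  n < a + b -> lmul x y n = 0.
Proof. by move=> xa yb; apply: lconv_lt. Qed.

Let lmulE x y (a b : int) (k : nat) :
    (forall i, i < a -> x i = 0) -> (forall i, i < b -> y i = 0) ->
  lmul x y (a + b + k%:Z) =
  \sum_(i < k.+1) x (a + i%:Z) * y (b + (k - i)%N%:Z).
Proof. exact: lconvE. Qed.

Let trunc (a : int) (m : nat) x : {poly K} := \poly_(i < m) x (a + i%:Z).

Let lmul_trunc x y (a b : int) (k m : nat) :
    (forall i, i < a -> x i = 0) -> (forall i, i < b -> y i = 0) ->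
  (k < m)%N -> lmul x y (a + b + k%:Z) = (trunc a m x * trunc b m y)`_k.
Proof.
move=> xa yb km; rewrite (lmulE _ xa yb) coefM.
apply: eq_bigr => i _; rewrite !coef_poly.
by rewrite !ifT//; have := ltn_ord i; lia.
Qed.

Let coef_truncM (p q p' q' : {poly K}) k :
  (forall i, (i <= k)%N -> p`_i = p'`_i) ->
  (forall i, (i <= k)%N -> q`_i = q'`_i) -> (p * q)`_k = (p' * q')`_k.
Proof.
move=> pp qq; rewrite !coefM; apply: eq_bigr => i _.
by rewrite pp ?qq//; have := ltn_ord i; lia.
Qed.

Lemma lmulC : commutative lmul.
Proof.
move=> x y; have [[a xa] [b yb]] := (laurent_bound x, laurent_bound y).
apply/laurentP => n; case: (ltP n (a + b)) => [nab|abn].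
  by rewrite (lmul_lt xa yb nab) (lmul_lt yb xa)// addrC.
have -> : n = a + b + Posz (absz (n - (a + b))%R) by lia.
set k := absz _; rewrite (@lmul_trunc _ _ _ _ _ k.+1)// mulrC.
by rewrite [a + b]addrC (@lmul_trunc _ _ _ _ _ k.+1).
Qed.

Lemma lmulA : associative lmul.
Proof.
move=> x y z; have [[a xa] [b yb]] := (laurent_bound x, laurent_bound y).
have [c zc] := laurent_bound z.
have xyab i : i < a + b -> lmul x y i = 0 by apply: lmul_lt.
have yzbc i : i < b + c -> lmul y z i = 0 by apply: lmul_lt.
apply/laurentP => n; case: (ltP n (a + b + c)) => [nab|abn].
  by rewrite (lmul_lt xa yzbc) ?addrA// (lmul_lt xyab zc).
have -> : n = a + b + c + Posz (absz (n - (a + b + c))%R) by lia.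
set k := absz _; rewrite [RHS](@lmul_trunc _ _ _ _ _ k.+1)//.
rewrite -[a + b + c]addrA [LHS](@lmul_trunc _ _ _ _ _ k.+1)//.
transitivity ((trunc a k.+1 x * (trunc b k.+1 y * trunc c k.+1 z))`_k).
  apply: coef_truncM => // i ik; rewrite [LHS]coef_poly ltnS ik.
  exact: lmul_trunc.
rewrite mulrA; apply: coef_truncM => // i ik; rewrite [RHS]coef_poly ltnS ik.
by rewrite -lmul_trunc.
Qed.

Let lmonom_lt (m : int) (c : K) i : i < m -> lmonom m c i = 0.
Proof. by move=> im /=; case: eqP => // iE; lia. Qed.

Lemma lmul1 : left_id (lmonom 0 1) lmul.
Proof.
move=> x; have [a xa] := laurent_bound x; apply/laurentP => n.
case: (ltP n a) => [na|an].
  by rewrite (lmul_lt (@lmonom_lt 0 1) xa) ?xa ?add0r.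
have -> : n = 0 + a + Posz (absz (n - a)%R) by lia.
rewrite (lmulE _ (@lmonom_lt 0 1) xa) big_ord_recl big1 ?addr0.
  by rewrite /= mul1r subn0 add0r.
by move=> i _; rewrite /= mul0r.
Qed.

Lemma lmulDl : left_distributive lmul +%R.
Proof.
move=> x y z; have [[a xa] [b yb]] := (laurent_bound x, laurent_bound y).
have [c zc] := laurent_bound z; set d := Num.min a b.
have xd i : i < d -> x i = 0 by rewrite /d lt_min => /andP[/xa].
have yd i : i < d -> y i = 0 by rewrite /d lt_min => /andP[_ /yb].
have xyd i : i < d -> (x + y) i = 0 by move=> id; rewrite lcoefD xd ?yd ?addr0.
apply/laurentP => n; rewrite lcoefD; case: (ltP n (d + c)) => [nd|dn].
  by rewrite !(lmul_lt _ zc nd)// addr0.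
have -> : n = d + c + Posz (absz (n - (d + c))%R) by lia.
rewrite (lmulE _ xyd zc) (lmulE _ xd zc) (lmulE _ yd zc) -big_split/=.
by apply: eq_bigr => i _; rewrite mulrDl.
Qed.

Lemma laurent1_neq0 : lmonom 0 1 != 0 :> laurent K.
Proof.
by apply/eqP => /laurentP/(_ 0) /=; apply/eqP; rewrite oner_eq0.
Qed.

HB.instance Definition _ := GRing.Zmodule_isComNzRing.Build (laurent K)
  lmulA lmulC lmul1 lmulDl laurent1_neq0.

Let invs (p : nat -> K) := fix invs (n : nat) : seq K :=
  if n is k.+1 then
    rcons (invs k)
      (((k == 0)%:R - \sum_(j < k) p (k - j)%N * (invs k)`_j) / p 0%N)
  else [::].

Let size_invs p n : size (invs p n) = n.
Proof. by elim: n => //= n IH; rewrite size_rcons IH. Qed.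

Let nth_invs p n j : (j < n)%N -> (invs p n)`_j = (invs p j.+1)`_j.
Proof.
elim: n => // n IH; rewrite ltnS leq_eqVlt => /orP[/eqP->//|jn].
by rewrite /= nth_rcons size_invs jn IH.
Qed.

Let invsP p k : p 0%N != 0 ->
  \sum_(j < k.+1) p (k - j)%N * (invs p j.+1)`_j = (k == 0)%:R.
Proof.
move=> p0; rewrite big_ord_recr /= subnn nth_rcons size_invs ltnn eqxx.
rewrite [X in _ + X]mulrC divfK// addrC -addrA [X in _ + X](_ : _ = 0) ?addr0//.
apply/eqP; rewrite addrC subr_eq0; apply/eqP/eq_bigr => j _.
by rewrite nth_invs//=.
Qed.

Lemma laurent_inv_ex x : x != 0 -> exists y, y * x = 1.
Proof.
move=> x0; have [a xa] := laurent_bound x.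
have [n xn] : exists n, x n != 0.
  apply: contrapT => /forallNP x0'; move/eqP: x0; apply; apply/laurentP => n.
  by apply/eqP/negPn/negP/x0'.
have [k xk kmin] : exists2 k : nat, x (a + k%:Z) != 0
    & forall j, x (a + j%:Z) != 0 -> (k <= j)%N.
  have ex : exists k : nat, x (a + k%:Z) != 0.
    exists (absz (n - a)%R); case: (ltP n a) => na; first by rewrite xa ?eqxx in xn.
    by rewrite (_ : a + _ = n)//; lia.
  by case: (ex_minnP ex) => k xk kmin; exists k.
set b := a + k%:Z in xk.
have xb i : i < b -> x i = 0.
  move=> ib; case: (ltP i a) => [/xa//|ai]; apply/eqP/negPn/negP => xi.
  have /kmin : x (a + Posz (absz (i - a)%R)) != 0 by rewrite (_ : a + _ = i)//; lia.
  by lia.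
pose p (i : nat) := x (b + i%:Z).
have y_sub : (fun i : int => if i < - b then 0 else (invs p (absz (i + b)%R).+1)`_(absz (i + b)%R))
    \in @bounded_below K.
  by apply/bounded_belowP; exists (- b) => i ->.
exists (Laurent y_sub); apply/laurentP => i; rewrite /= -/(lmul _ _).
have yb j : j < - b -> Laurent y_sub j = 0 by move=> /= ->.
case: (ltP i 0) => i0.
  by rewrite [LHS](lmul_lt yb xb) ?addNr//=; case: eqP => // iE; lia.
have -> : i = - b + b + Posz (absz i) by lia.
rewrite [LHS](lmulE _ yb xb) addNr add0r.
transitivity ((absz i == 0%N)%:R : K); last first.
  by have -> : (absz i == 0%N) = (Posz (absz i) == 0) by []; case: (_ == 0).
rewrite -(@invsP p) ?/p ?addr0//; apply: eq_bigr => j _.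
rewrite mulrC /=; have -> : (- b + j%:Z < - b) = false by lia.
by have -> : absz (- b + (j : nat)%:Z + b)%R = j by lia.
Qed.

Let linv x : laurent K := xget 0 [set y | y * x = 1]%classic.

Let linvP x : x != 0 -> linv x * x = 1.
Proof. by move=> /laurent_inv_ex[y yx]; rewrite /linv; case: xgetP => [z _ //|/(_ y)]. Qed.

Let linv0 : linv 0 = 0.
Proof.
rewrite /linv; case: xgetP => // z _ /=; rewrite mulr0 => /esym/eqP.
by rewrite oner_eq0.
Qed.

HB.instance Definition _ := GRing.ComNzRing_isField.Build (laurent K)
  linvP linv0.

End LaurentField.

Lemma lcoefM (K : fieldType) (f g : laurent K) n :
  (f * g) n = lconv (@mul0r K) (@mulr0 K) f g n.
Proof. by []. Qed.

Section LaurentCalculus.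
Variable V : zmodType.

Fact lderiv_subproof (x : laurent V) :
  (fun n : int => x (n + 1) *~ (n + 1)) \in @bounded_below V.
Proof.
have [a xa] := laurent_bound x; apply/bounded_belowP; exists (a - 1) => n na.
by rewrite xa ?mul0rz//; lia.
Qed.

Definition lderiv (x : laurent V) : laurent V := Laurent (lderiv_subproof x).

Definition lres (x : laurent V) : V := x (-1).

Lemma lres_deriv x : lres (lderiv x) = 0.
Proof. by rewrite /lres /= addNr mulr0z. Qed.

End LaurentCalculus.

(* For finite-dimensional V, laurent V is the tensor product of V with K((xi)),
   with X (x) f given by ltensor X f; see ltensor_coord. *)
Fact ltensor_subproof (K : fieldType) (V : lmodType K) (X : V) (f : laurent K) :
  (fun n : int => f n *: X) \in @bounded_below V.
Proof.
have [a fa] := laurent_bound f; apply/bounded_belowP; exists a => n na.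
by rewrite fa ?scale0r.
Qed.

Definition ltensor (K : fieldType) (V : lmodType K) (X : V) (f : laurent K) :
  laurent V := Laurent (ltensor_subproof X f).

Fact lmap_subproof (K : fieldType) (U V : lmodType K) (u : {linear U -> V})
  (x : laurent U) : (fun n : int => u (x n)) \in @bounded_below V.
Proof.
have [a xa] := laurent_bound x; apply/bounded_belowP; exists a => n na.
by rewrite xa ?linear0.
Qed.

Definition lmap (K : fieldType) (U V : lmodType K) (u : {linear U -> V})
  (x : laurent U) : laurent V := Laurent (lmap_subproof u x).

Lemma lmap_tensor (K : fieldType) (U V : lmodType K) (u : {linear U -> V})
  (X : U) (f : laurent K) : lmap u (ltensor X f) = ltensor (u X) f.
Proof. by apply/laurentP => n /=; rewrite linearZ. Qed.

Lemma lderivM (K : fieldType) (f g : laurent K) :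
  lderiv (f * g) = lderiv f * g + f * lderiv g.
Proof.
have [[a fa] [b gb]] := (laurent_bound f, laurent_bound g).
have f'a i : i < a - 1 -> lderiv f i = 0 by move=> ia; rewrite /= fa ?mul0rz//; lia.
have g'b i : i < b - 1 -> lderiv g i = 0 by move=> ib; rewrite /= gb ?mul0rz//; lia.
apply/laurentP => n; rewrite lcoefD.
rewrite [lderiv (f * g) n]/((f * g) (n + 1) *~ (n + 1)).
rewrite !lcoefM.
case: (ltP (n + 1) (a + b)) => nab.
  have n1 : n < a - 1 + b by lia.
  have n2 : n < a + (b - 1) by lia.
  rewrite (lconv_lt _ _ fa gb nab) (lconv_lt _ _ f'a gb n1).
  by rewrite (lconv_lt _ _ fa g'b n2) [LHS]mul0rz addr0.
set k := absz (n + 1 - (a + b))%R.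
have -> : lconv (@mul0r K) (@mulr0 K) f g (n + 1) =
    \sum_(i < k.+1) f (a + i%:Z) * g (b + (k - i)%N%:Z).
  by rewrite -(lconvE (@mul0r K) (@mulr0 K) _ fa gb); congr (lconv _ _ _ _ _); lia.
have -> : lconv (@mul0r K) (@mulr0 K) (lderiv f) g n =
    \sum_(i < k.+1) lderiv f (a - 1 + i%:Z) * g (b + (k - i)%N%:Z).
  by rewrite -(lconvE (@mul0r K) (@mulr0 K) _ f'a gb); congr (lconv _ _ _ _ _); lia.
have -> : lconv (@mul0r K) (@mulr0 K) f (lderiv g) n =
    \sum_(i < k.+1) f (a + i%:Z) * lderiv g (b - 1 + (k - i)%N%:Z).
  by rewrite -(lconvE (@mul0r K) (@mulr0 K) _ fa g'b); congr (lconv _ _ _ _ _); lia.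
rewrite -big_split/= [LHS]mulrz_suml; apply: eq_bigr => i _.
rewrite [a - 1 + _ + 1](_ : _ = a + i%:Z); last by lia.
rewrite [b - 1 + _ + 1](_ : _ = b + (k - i)%N%:Z); last by lia.
rewrite mulrzAl mulrzAr -[RHS]mulrzDr; congr (_ *~ _).
by have := ltn_ord i; lia.
Qed.

Section ConvolutionLinear.
Variables (K : fieldType) (U V W : lmodType K) (op : U -> V -> W).
Hypotheses (op0l : forall v, op 0 v = 0) (op0r : forall u, op u 0 = 0).
Hypotheses
  (opl : forall v, linear (op^~ v)) (opr : forall u, linear (op u)).

Lemma lconv_linearl y : linear ((lconv op0l op0r)^~ y).
Proof.
move=> c x x'; have [[a xa] [b yb]] := (laurent_bound x, laurent_bound y).
have [a' x'a] := laurent_bound x'; set d := Num.min a a'.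
have xd i : i < d -> x i = 0 by rewrite /d lt_min => /andP[/xa].
have x'd i : i < d -> x' i = 0 by rewrite /d lt_min => /andP[_ /x'a].
have xx'd i : i < d -> (c *: x + x') i = 0.
  by move=> id; rewrite lcoefD lcoefZ xd ?x'd ?scaler0 ?addr0.
apply/laurentP => n; rewrite lcoefD lcoefZ.
case: (ltP n (d + b)) => [nd|dn].
  by rewrite !(lconv_lt _ _ _ yb nd)// scaler0 addr0.
have -> : n = d + b + Posz (absz (n - (d + b))%R) by lia.
rewrite (lconvE _ _ _ xx'd yb) (lconvE _ _ _ xd yb) (lconvE _ _ _ x'd yb).
by rewrite scaler_sumr -big_split/=; apply: eq_bigr => i _; rewrite opl.
Qed.

Lemma lconv_linearr x : linear (lconv op0l op0r x).
Proof.
move=> c y y'; have [[a xa] [b yb]] := (laurent_bound x, laurent_bound y).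
have [b' y'b] := laurent_bound y'; set d := Num.min b b'.
have yd i : i < d -> y i = 0 by rewrite /d lt_min => /andP[/yb].
have y'd i : i < d -> y' i = 0 by rewrite /d lt_min => /andP[_ /y'b].
have yy'd i : i < d -> (c *: y + y') i = 0.
  by move=> id; rewrite lcoefD lcoefZ yd ?y'd ?scaler0 ?addr0.
apply/laurentP => n; rewrite lcoefD lcoefZ.
case: (ltP n (a + d)) => [nd|dn].
  by rewrite !(lconv_lt _ _ xa _ nd)// scaler0 addr0.
have -> : n = a + d + Posz (absz (n - (a + d))%R) by lia.
rewrite (lconvE _ _ _ xa yy'd) (lconvE _ _ _ xa yd) (lconvE _ _ _ xa y'd).
by rewrite scaler_sumr -big_split/=; apply: eq_bigr => i _; rewrite opr.
Qed.

Lemma lconv_tensor (X : U) (Y : V) (f g : laurent K) :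
  lconv op0l op0r (ltensor X f) (ltensor Y g) = ltensor (op X Y) (f * g).
Proof.
have [[a fa] [b gb]] := (laurent_bound f, laurent_bound g).
have Xf i : i < a -> ltensor X f i = 0 by move=> ia; rewrite /= fa ?scale0r.
have Yg i : i < b -> ltensor Y g i = 0 by move=> ib; rewrite /= gb ?scale0r.
apply/laurentP => n; rewrite [RHS](_ : _ = (f * g) n *: op X Y)// lcoefM.
case: (ltP n (a + b)) => [nab|abn].
  by rewrite (lconv_lt _ _ Xf Yg nab) (lconv_lt _ _ fa gb nab) scale0r.
have -> : n = a + b + Posz (absz (n - (a + b))%R) by lia.
rewrite (lconvE _ _ _ Xf Yg) (lconvE _ _ _ fa gb) scaler_suml.
apply: eq_bigr => i _ /=.
have := opl (g (b + (absz (n - (a + b))%R - i)%N%:Z) *: Y) (f (a + i%:Z)) X 0.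
rewrite !addr0 op0l addr0 => ->.
have := opr X (g (b + (absz (n - (a + b))%R - i)%N%:Z)) Y 0.
by rewrite !addr0 op0r addr0 => ->; rewrite scalerA.
Qed.

End ConvolutionLinear.

Section TensorSpan.
Variables (K : fieldType) (V : vectType K).

Lemma ltensor_coord (x : laurent V) : x =
  \sum_(i < \dim {:V}) ltensor (vbasis {:V})`_i
     (lmap (coord (vbasis {:V}) i : {linear V -> K^o}) x).
Proof.
apply/laurentP => n; rewrite lcoef_sum /=.
exact/coord_vbasis/memvf.
Qed.

Lemma ltensor_ind (P : laurent V -> Prop) :
  (forall X f, P (ltensor X f)) -> (forall x y, P x -> P y -> P (x + y)) ->
  forall x, P x.
Proof.
move=> Pt PD x; rewrite (ltensor_coord x).
have P0 : P 0 by have := Pt 0 0; congr P; apply/laurentP => n /=; rewrite scaler0.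
by elim/big_ind: _ => // i _; apply: Pt.
Qed.

Lemma lderiv_tensor (X : V) (f : laurent K) :
  lderiv (ltensor X f) = ltensor X (lderiv f).
Proof. by apply/laurentP => n /=; rewrite scalerMzl. Qed.

End TensorSpan.


HB.mixin Record isLieAlgebra (K : fieldType) L of GRing.Lmodule K L := {
  lie : L -> L -> L;
  lie_linearl : forall y, linear (lie^~ y);
  lie_linearr : forall x, linear (lie x);
  liexx : forall x, lie x x = 0;
  lie_jacobi : forall x y z,
    lie x (lie y z) + lie y (lie z x) + lie z (lie x y) = 0 }.

#[short(type="lieAlgType")]
HB.structure Definition LieAlgebra (K : fieldType) :=
  { L of GRing.Lmodule K L & isLieAlgebra K L }.

#[short(type="finLieAlgType")]
HB.structure Definition FinLieAlgebra (K : fieldType) :=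
  { L of Vector K L & isLieAlgebra K L }.

Section LieTheory.
Variables (K : fieldType) (L : lieAlgType K).
Implicit Types x y z : L.

HB.instance Definition _ x :=
  GRing.isLinear.Build K L L *:%R (lie x) (lie_linearr x).

Lemma lie0r x : lie x 0 = 0. Proof. exact: linear0. Qed.

Lemma lieDl x y z : lie (x + y) z = lie x z + lie y z.
Proof. by have := lie_linearl z 1 x y; rewrite !scale1r. Qed.

Lemma lieC x y : lie x y = - lie y x.
Proof.
apply/eqP; rewrite -addr_eq0; have := liexx (x + y).
by rewrite lieDl !linearD/= !liexx add0r addr0 addrC => ->.
Qed.

Lemma lie0l x : lie 0 x = 0. Proof. by rewrite lieC lie0r oppr0. Qed.

Lemma lieZl c x y : lie (c *: x) y = c *: lie x y.
Proof. by rewrite lieC linearZ/= -scalerN -lieC. Qed.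

End LieTheory.

Section ProductLie.
Variables (K : fieldType) (L1 L2 : lieAlgType K).

Definition prod_lie (x y : L1 * L2) : L1 * L2 := (lie x.1 y.1, lie x.2 y.2).

Fact prod_lie_linearl y : linear (prod_lie^~ y).
Proof. by move=> c x x'; congr pair; apply: lie_linearl. Qed.
Fact prod_lie_linearr x : linear (prod_lie x).
Proof. by move=> c y y'; congr pair; apply: lie_linearr. Qed.
Fact prod_liexx x : prod_lie x x = 0.
Proof. by congr pair; apply: liexx. Qed.
Fact prod_lie_jacobi x y z : prod_lie x (prod_lie y z)
  + prod_lie y (prod_lie z x) + prod_lie z (prod_lie x y) = 0.
Proof. by congr pair; apply: lie_jacobi. Qed.

HB.instance Definition _ := isLieAlgebra.Build K (L1 * L2)%type
  prod_lie_linearl prod_lie_linearr prod_liexx prod_lie_jacobi.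

End ProductLie.

Definition lie_morphism (K : fieldType) (L M : lieAlgType K)
    (u : L -> M) : Prop :=
  linear u /\ forall x y, u (lie x y) = lie (u x) (u y).

Definition lie_automorphism (K : fieldType) (L : lieAlgType K)
    (u : L -> L) : Prop :=
  lie_morphism u /\ bijective u.

Section FinLie.
Variables (K : fieldType) (a : finLieAlgType K).

Definition lie_ideal (I : {vspace a}) : Prop :=
  forall x y : a, y \in I -> lie x y \in I.

Definition simple_lie : Prop :=
  (exists x y : a, lie x y != 0) /\
  (forall I : {vspace a}, lie_ideal I -> I = 0%VS \/ I = fullv).

Definition ad (x : a) : 'End(a) := linfun (lie x).

Definition lfun_trace (u : 'End(a)) : K :=
  \tr (passmx.mxof (vbasis fullv) (vbasis fullv) u).

Definition killing (x y : a) : K := lfun_trace (ad x \o ad y)%VF.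

Definition lfun_diagonalizable (u : 'End(a)) : Prop :=
  exists2 b : seq a, basis_of fullv b &
    forall v, v \in b -> exists c : K, u v = c *: v.

Definition abelian_subspace (t : {vspace a}) : Prop :=
  forall x y : a, x \in t -> y \in t -> lie x y = 0.

(* Cartan subalgebras of a complex semisimple Lie algebra: maximal abelian
   subalgebras all of whose elements are ad-semisimple. *)
Definition cartan (t : {vspace a}) : Prop :=
  [/\ abelian_subspace t,
      forall t' : {vspace a}, abelian_subspace t' -> (t <= t')%VS -> t' = t &
      forall x : a, x \in t -> lfun_diagonalizable (ad x)].

Section Roots.
Variable t : {vspace a}.

Definition root_vector (alpha : 'Hom(subvs_of t, K^o)) (X : a) : Prop :=
  forall h : subvs_of t, lie (vsval h) X = (alpha h : K) *: X.

Definition is_root (alpha : 'Hom(subvs_of t, K^o)) : Prop :=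
  alpha != 0 /\ exists2 X : a, X != 0 & root_vector alpha X.

Definition coweight (x : a) : Prop :=
  x \in t /\ forall alpha, is_root alpha ->
    exists k : int, alpha (vsproj t x) = k%:~R.

(* h is the element of t identified with alpha by the form B *)
Definition dual_vector (B : a -> a -> K) (alpha : 'Hom(subvs_of t, K^o))
    (h : subvs_of t) : Prop :=
  forall h' : subvs_of t, B (vsval h) (vsval h') = alpha h'.

End Roots.
End FinLie.

Section NormalizedForm.
Variables (K : numFieldType) (a : finLieAlgType K) (t : {vspace a}).

Definition normalizing_scalar (c : K) : Prop :=
  let B x y := c * killing x y in
  (forall alpha (h : subvs_of t), is_root alpha -> dual_vector B alpha h ->
     B (vsval h) (vsval h) <= 2) /\
  (exists alpha (h : subvs_of t), [/\ is_root alpha, dual_vector B alpha h &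
     B (vsval h) (vsval h) = 2]).

(* The normalizing scalar exists and is unique when a is complex simple and t a
   Cartan subalgebra; the default value 0 is otherwise irrelevant. *)
Definition nform (x y : a) : K :=
  xget 0 [set c | normalizing_scalar c]%classic * killing x y.

End NormalizedForm.

Section KillingTheory.
Variables (K : numFieldType) (a : finLieAlgType K) (t : {vspace a}).
Implicit Types x y z : a.

Let e := vbasis {:a}.
Let eP : basis_of {:a} e := vbasisP _.

Lemma adE x y : ad x y = lie x y. Proof. exact: lfunE. Qed.

Lemma ad_lie x y : ad (lie x y) = (ad x \o ad y)%VF - (ad y \o ad x)%VF.
Proof.
apply/lfunP => z.
rewrite add_lfunE opp_lfunE !comp_lfunE !adE.
have /eqP := lie_jacobi x y z.
by rewrite [lie z x]lieC linearN/= [lie z _]lieC subr_eq0 => /eqP <-.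
Qed.

Lemma ad_linear c x y : ad (c *: x + y) = c *: ad x + ad y.
Proof.
by apply/lfunP => z; rewrite add_lfunE scale_lfunE !adE lie_linearl.
Qed.

Lemma lfun_trace_linear : linear_for *%R (@lfun_trace K a).
Proof. by move=> c u v; rewrite /lfun_trace passmx.mxof_linear mxtraceD mxtraceZ. Qed.

Lemma lfun_traceC (u v : 'End(a)) :
  lfun_trace (u \o v)%VF = lfun_trace (v \o u)%VF.
Proof. by rewrite /lfun_trace !(passmx.mxof_comp _ _ eP) mxtrace_mulC. Qed.

Lemma killingC x y : killing x y = killing y x.
Proof. exact: lfun_traceC. Qed.

Lemma killing_linearr x : linear_for *%R (killing x).
Proof.
move=> c y z; rewrite /killing ad_linear -lfun_trace_linear; congr lfun_trace.
by rewrite comp_lfunDr comp_lfunZr.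
Qed.

Lemma lfun_traceB (u v : 'End(a)) :
  lfun_trace (u - v) = lfun_trace u - lfun_trace v.
Proof. by rewrite addrC -scaleN1r lfun_trace_linear mulN1r addrC. Qed.

Lemma killing_lie x y z : killing (lie x y) z = killing x (lie y z).
Proof.
rewrite /killing !ad_lie comp_lfunDl comp_lfunNl comp_lfunDr comp_lfunNr.
rewrite !lfun_traceB comp_lfunA; congr (_ - _).
by rewrite -comp_lfunA lfun_traceC comp_lfunA.
Qed.

Lemma nformC x y : nform t x y = nform t y x.
Proof. by rewrite /nform killingC. Qed.

Lemma nform_linearr x : linear_for *%R (nform t x).
Proof.
by move=> c y z; rewrite /nform killing_linearr mulrDr mulrCA.
Qed.

Lemma nform_linearl y : linear_for *%R ((nform t)^~ y).
Proof. by move=> c x z; rewrite /= !(nformC _ y) nform_linearr. Qed.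

Lemma nform_lie x y z : nform t (lie x y) z = nform t x (lie y z).
Proof. by rewrite /nform killing_lie. Qed.

Lemma nform0l y : nform t 0 y = 0.
Proof. by have := nform_linearl y (-1) 0 0; rewrite scaler0 addr0 mulN1r addNr. Qed.

Lemma nform0r x : nform t x 0 = 0.
Proof. by rewrite nformC nform0l. Qed.

End KillingTheory.


Section Affine.
Variables (K : numFieldType) (a : finLieAlgType K).

(* a((xi)) + K c, with bracket relative to the form normalized along t *)
Definition affine of {vspace a} : Type := (laurent a * K^o)%type.

Variable t : {vspace a}.

HB.instance Definition _ := GRing.Lmodule.copy (affine t) (laurent a * K^o)%type.

Definition loop (X : a) (f : laurent K) : affine t := (ltensor X f, 0).
Definition central : affine t := (0, 1).

Definition loop_bracket : laurent a -> laurent a -> laurent a :=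
  lconv (@lie0l K a) (@lie0r K a).

Definition loop_form : laurent a -> laurent a -> laurent K^o :=
  @lconv a a K^o (nform t) (nform0l t) (nform0r t).

Definition loop_cocycle (x y : laurent a) : K := lres (loop_form (lderiv x) y).

(* On pure tensors the coefficient of c is <X, Y> Res (g df); see
   affine_bracket_loop. *)
Definition affine_bracket (x y : affine t) : affine t :=
  (loop_bracket x.1 y.1, loop_cocycle x.1 y.1).

Lemma loop_bracket_tensor X Y f g :
  loop_bracket (ltensor X f) (ltensor Y g) = ltensor (lie X Y) (f * g).
Proof. exact: (lconv_tensor _ _ (@lie_linearl K a) (@lie_linearr K a)). Qed.

Lemma loop_cocycle_tensor X Y f g :
  loop_cocycle (ltensor X f) (ltensor Y g) = nform t X Y * lres (g * lderiv f).
Proof.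
rewrite /loop_cocycle lderiv_tensor.
have -> : loop_form (ltensor X (lderiv f)) (ltensor Y g) =
    ltensor (nform t X Y : K^o) (lderiv f * g).
  exact: (@lconv_tensor K a a K^o _ _ _ (nform_linearl t) (nform_linearr t)).
by rewrite [RHS]mulrC [g * _]mulrC.
Qed.

Lemma affine_bracket_loop X Y f g : affine_bracket (loop X f) (loop Y g) =
  loop (lie X Y) (f * g) + (nform t X Y * lres (g * lderiv f)) *: central.
Proof.
rewrite /affine_bracket loop_bracket_tensor loop_cocycle_tensor.
by congr pair; rewrite /= ?scaler0 ?addr0// add0r [RHS]mulr1.
Qed.

Lemma loop_bracketl y : linear (loop_bracket^~ y).
Proof. exact: (lconv_linearl _ _ (@lie_linearl K a)). Qed.

Lemma loop_bracketr x : linear (loop_bracket x).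
Proof. exact: (lconv_linearr _ _ (@lie_linearr K a)). Qed.

Lemma loop_cocyclel y : linear_for *%R (loop_cocycle^~ y).
Proof.
move=> c x x'; rewrite /loop_cocycle.
have -> : lderiv (c *: x + x') = c *: lderiv x + lderiv x'.
  by apply/laurentP => n; rewrite /= mulrzDl scalerMzr.
by rewrite /loop_form (@lconv_linearl K a a K^o _ _ _ (nform_linearl t)).
Qed.

Lemma loop_cocycler x : linear_for *%R (loop_cocycle x).
Proof.
move=> c y y'; rewrite /loop_cocycle.
by rewrite /loop_form (@lconv_linearr K a a K^o _ _ _ (nform_linearr t)).
Qed.

Let lbDl x x' y : loop_bracket (x + x') y = loop_bracket x y + loop_bracket x' y.
Proof. by have := loop_bracketl y 1 x x'; rewrite !scale1r. Qed.
Let lbDr x y y' : loop_bracket x (y + y') = loop_bracket x y + loop_bracket x y'.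
Proof. by have := loop_bracketr x 1 y y'; rewrite !scale1r. Qed.
Let lcDl x x' y : loop_cocycle (x + x') y = loop_cocycle x y + loop_cocycle x' y.
Proof. by have := loop_cocyclel y 1 x x'; rewrite scale1r mul1r. Qed.
Let lcDr x y y' : loop_cocycle x (y + y') = loop_cocycle x y + loop_cocycle x y'.
Proof. by have := loop_cocycler x 1 y y'; rewrite scale1r mul1r. Qed.

Let lbC x y : loop_bracket x y + loop_bracket y x = 0.
Proof.
elim/ltensor_ind: x => [X f|x x' IH IH']; last first.
  by rewrite lbDl lbDr addrACA IH IH' addr0.
elim/ltensor_ind: y => [Y g|y y' IH IH']; last first.
  by rewrite lbDl lbDr addrACA IH IH' addr0.
rewrite !loop_bracket_tensor lieC [g * f]mulrC; apply/laurentP => n.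
by rewrite lcoefD /= scalerN addNr.
Qed.

Let lcC x y : loop_cocycle x y + loop_cocycle y x = 0.
Proof.
elim/ltensor_ind: x => [X f|x x' IH IH']; last first.
  by rewrite lcDl lcDr addrACA IH IH' addr0.
elim/ltensor_ind: y => [Y g|y y' IH IH']; last first.
  by rewrite lcDl lcDr addrACA IH IH' addr0.
rewrite !loop_cocycle_tensor nformC -mulrDr.
have -> : lres (g * lderiv f) + lres (f * lderiv g) = lres (lderiv (f * g)).
  by rewrite lderivM [lderiv f * g]mulrC.
by rewrite lres_deriv mulr0.
Qed.

Let add3 (V : zmodType) (u u' v v' w w' : V) :
  (u + u') + (v + v') + (w + w') = (u + v + w) + (u' + v' + w').
Proof. by rewrite (addrACA u) (addrACA (u + v)). Qed.

Let lb_jacobi x y z : loop_bracket x (loop_bracket y z)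
  + loop_bracket y (loop_bracket z x) + loop_bracket z (loop_bracket x y) = 0.
Proof.
elim/ltensor_ind: x => [X f|x x' IH IH']; last first.
  by rewrite !(lbDl, lbDr) add3 IH IH' addr0.
elim/ltensor_ind: y => [Y g|y y' IH IH']; last first.
  by rewrite !(lbDl, lbDr) add3 IH IH' addr0.
elim/ltensor_ind: z => [Z h|z z' IH IH']; last first.
  by rewrite !(lbDl, lbDr) add3 IH IH' addr0.
rewrite !loop_bracket_tensor.
have -> : g * (h * f) = f * (g * h) by rewrite mulrA mulrC.
have -> : h * (f * g) = f * (g * h) by rewrite mulrC mulrA.
apply/laurentP => n; rewrite !lcoefD /= -!scalerDr lie_jacobi.
exact: scaler0.
Qed.

Let lc_jacobi x y z : loop_cocycle x (loop_bracket y z)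
  + loop_cocycle y (loop_bracket z x) + loop_cocycle z (loop_bracket x y) = 0.
Proof.
elim/ltensor_ind: x => [X f|x x' IH IH']; last first.
  by rewrite !(lbDl, lbDr, lcDl, lcDr) add3 IH IH' addr0.
elim/ltensor_ind: y => [Y g|y y' IH IH']; last first.
  by rewrite !(lbDl, lbDr, lcDl, lcDr) add3 IH IH' addr0.
elim/ltensor_ind: z => [Z h|z z' IH IH']; last first.
  by rewrite !(lbDl, lbDr, lcDl, lcDr) add3 IH IH' addr0.
rewrite !loop_bracket_tensor !loop_cocycle_tensor.
rewrite -(nform_lie t X Y Z) -(nform_lie t Y Z X) [nform t (lie Y Z) X]nformC.
rewrite -(nform_lie t X Y Z) [nform t Z _]nformC -!mulrDr.
have -> : lres (g * h * lderiv f) + lres (h * f * lderiv g)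
    + lres (f * g * lderiv h) = lres (lderiv (f * g * h)).
  transitivity (lres (g * h * lderiv f + h * f * lderiv g + f * g * lderiv h)).
    by [].
  by congr lres; rewrite !lderivM; ring.
by rewrite lres_deriv mulr0.
Qed.

Fact affine_linearl y : linear (affine_bracket^~ y).
Proof. by move=> c x x'; congr pair; [exact: loop_bracketl|exact: loop_cocyclel]. Qed.

Fact affine_linearr x : linear (affine_bracket x).
Proof. by move=> c y y'; congr pair; [exact: loop_bracketr|exact: loop_cocycler]. Qed.

Fact affine_xx x : affine_bracket x x = 0.
Proof.
have twice (V : lmodType K) (v : V) : v + v = 0 -> v = 0.
  move=> /eqP; rewrite -mulr2n -scaler_nat scaler_eq0 pnatr_eq0 /=.
  exact: eqP.
by congr pair; [exact/twice/lbC|apply: (twice K^o); exact: lcC].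
Qed.

Fact affine_jacobi x y z : affine_bracket x (affine_bracket y z)
  + affine_bracket y (affine_bracket z x)
  + affine_bracket z (affine_bracket x y) = 0.
Proof. by congr pair; [exact: lb_jacobi|exact: lc_jacobi]. Qed.

HB.instance Definition _ := isLieAlgebra.Build K (affine t)
  affine_linearl affine_linearr affine_xx affine_jacobi.

End Affine.

Arguments loop {K a} t X f.
Arguments central {K a} t.

Section MultiShift.
Variables (K : numFieldType) (a : finLieAlgType K) (t : {vspace a}).
Variables (n : nat) (z : 'I_n -> K).

(* 1 / (xi + (z_i - z_s)), expanded in K((xi)) *)
Definition shift_factor (i s : 'I_n) : laurent K :=
  (lmonom 1 1 + lmonom 0 (z i - z s))^-1.

Record is_multi_shift (nu : 'I_n -> a) (i : 'I_n)
    (sigma : affine t -> affine t) : Prop := {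
  multi_shift_auto : lie_automorphism sigma;
  multi_shift_central : sigma (central t) = central t;
  multi_shift_cartan : forall (h : a) (f : laurent K), h \in t ->
    sigma (loop t h f) = loop t h f
      + (\sum_(s < n) nform t h (nu s) * lres (shift_factor i s * f))
          *: central t;
  (* the exponent k s is the integer alpha (nu s), nu s being a coweight *)
  multi_shift_root : forall (alpha : 'Hom(subvs_of t, K^o)) (X : a)
      (f : laurent K) (k : 'I_n -> int),
    is_root alpha -> root_vector alpha X ->
    (forall s, alpha (vsproj t (nu s)) = (k s)%:~R) ->
    sigma (loop t X f) =
      loop t X (f * \prod_(s < n) shift_factor i s ^ (- k s)) }.

End MultiShift.

Definition dynkin_index (K : numFieldType) (b a : finLieAlgType K)
    (s : {vspace b}) (t : {vspace a}) (u : b -> a) (l : K) : Prop :=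
  forall X Y : b, nform t (u X) (u Y) = l * nform s X Y.

Definition affine_map (K : numFieldType) (b a : finLieAlgType K)
    (s : {vspace b}) (t : {vspace a}) (u : {linear b -> a}) (l : K)
    (x : affine s) : affine t :=
  (lmap u x.1, x.2 * l).

Section Restrictions.
Variables (K : fieldType) (L1 L2 M : lmodType K).
Variable phi : {linear (L1 * L2)%type -> M}.

Definition restr1 (x : L1) : M := phi (x, 0).
Definition restr2 (x : L2) : M := phi (0, x).

Fact restr1_linear : linear restr1.
Proof.
by move=> c x y; rewrite /restr1 -linearP; congr (phi (_, _)); rewrite /= scaler0 addr0.
Qed.
Fact restr2_linear : linear restr2.
Proof.
by move=> c x y; rewrite /restr2 -linearP; congr (phi (_, _)); rewrite /= scaler0 addr0.
Qed.

HB.instance Definition _ :=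
  GRing.isLinear.Build K L1 M *:%R restr1 restr1_linear.
HB.instance Definition _ :=
  GRing.isLinear.Build K L2 M *:%R restr2 restr2_linear.

End Restrictions.

Definition affine_map2 (K : numFieldType) (b1 b2 a : finLieAlgType K)
    (s1 : {vspace b1}) (s2 : {vspace b2}) (t : {vspace a})
    (phi : {linear (b1 * b2)%type -> a}) (l1 l2 : K)
    (x : (affine s1 * affine s2)%type) : affine t :=
  affine_map t (restr1 phi) l1 x.1 + affine_map t (restr2 phi) l2 x.2.

(* Main.v *)
(** Decompose the sources under the Cartan subalgebras [h1] and [h2].  For a
    root vector [X] of [g_1], every weight component of [phi_1 X] has a weight
    which restricts along [phi_1] to the root of [X]: it is therefore a root,
    and it takes the same values on [phi_1 (mu_s)] as the root of [X] on
    [mu_s].  For a root vector [X] of [g_2], those values vanish because the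
    images of [g_1] and [g_2] commute.  On [h2] the central correction vanishes
    because [g_1] is perfect, so that by invariance of the Killing form
    [phi_1 g_1] and [phi_2 g_2] are orthogonal. *)

Require Import Defs.
From HB Require Import structures.
From mathcomp Require Import all_boot all_order all_algebra.
From mathcomp Require Import boolp classical_sets reals complex.

Set Implicit Arguments.
Unset Strict Implicit.
Unset Printing Implicit Defensive.

Import Order.TTheory GRing.Theory Num.Theory.
Local Open Scope ring_scope.

(** * Eigencomponents inside a stable subspace *)

Section SubspaceEigenvectors.
Variables (K : fieldType) (V : vectType K) (S : V -> Prop).
Hypothesis S_lin : forall c x y, S x -> S y -> S (c *: x + y).

(** Applying [A - d0] kills the component of eigenvalue [d0] and multiplies each of the others by a
    nonzero scalar, which allows induction on the list of eigenvalues. *)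
Lemma eigencomponents_stable (A : 'End(V)) (r : seq K) (w : K -> V) :
  (forall x, S x -> S (A x)) -> uniq r -> (forall d, A (w d) = d *: w d) ->
  S (\sum_(d <- r) w d) -> forall d, d \in r -> S (w d).
Proof.
move=> SA; elim: r w => [//|d0 r IH] w /= /andP[d0r r_uniq] wE Sw.
have S0 : S 0 by rewrite -(addNr (\sum_(d <- d0 :: r) w d)) -scaleN1r; apply: S_lin.
have Sr d : d \in r -> S (w d).
  move=> dr; have ddN0 : d - d0 != 0 by rewrite subr_eq0; apply: contraNneq d0r => <-.
  suff /(S_lin (d - d0)^-1)/(_ S0) : S ((d - d0) *: w d).
    by rewrite addr0 scalerA mulVf// scale1r.
  apply: (IH (fun d => (d - d0) *: w d)) => //.
    by move=> e; rewrite linearZ /= wE !scalerA mulrC.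
  have := S_lin (- d0) Sw (SA _ Sw); congr S.
  rewrite big_cons scalerDr linearD /= wE addrACA scaleNr addNr add0r.
  rewrite scaler_sumr linear_sum -big_split /=; apply: eq_bigr => e _.
  by rewrite wE scalerBl scaleNr addrC.
move=> d; rewrite inE => /predU1P[->|/Sr//].
have -> : w d0 = - 1 *: (\sum_(e <- r) w e) + \sum_(e <- d0 :: r) w e.
  by rewrite big_cons scaleN1r addrCA addNr addr0.
apply: (S_lin) => //; move: Sr; elim: (r) => [|e r' IHr] Sr.
  by rewrite big_nil.
rewrite big_cons -[w e]scale1r; apply: S_lin; first by apply: Sr; rewrite mem_head.
by apply: IHr => e' e'r; apply: Sr; rewrite inE e'r orbT.
Qed.

End SubspaceEigenvectors.

(** * Weight vectors of a Cartan subalgebra *)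

Section WeightDecomposition.
Variables (K : fieldType) (a : finLieAlgType K).

(** Every vector of [S] is the sum of its eigencomponents, and these stay in [S]. Keeping a subspace
    [S] in the principle lets further eigenvalue conditions be imposed one after another. *)
Lemma diagonalizable_eigen_ind (A : 'End(a)) (S P : a -> Prop) :
  lfun_diagonalizable A ->
  (forall c x y, S x -> S y -> S (c *: x + y)) ->
  (forall x, S x -> S (A x)) ->
  P 0 -> (forall x y, P x -> P y -> P (x + y)) ->
  (forall c x, S x -> A x = c *: x -> P x) ->
  forall x, S x -> P x.
Proof.
case=> b b_basis bA S_lin SA P0 PD Peig x Sx.
have /choice[ev evP] : forall v, exists c : K, v \in b -> A v = c *: v.
  by move=> v; have [/bA[c]|_] := boolP (v \in b); [exists c|exists 0].
(* [w d] gathers the coordinates of [x] along the basis vectors of eigenvalue [d]. *)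
pose X := in_tuple b; pose w d := \sum_(i < size b | ev X`_i == d) coord X i x *: X`_i.
pose r := undup (map ev b).
have wE d : A (w d) = d *: w d.
  rewrite linear_sum scaler_sumr; apply: eq_bigr => i /eqP <-.
  by rewrite linearZ /= evP ?mem_nth// !scalerA mulrC.
have xE : x = \sum_(d <- r) w d.
  rewrite {1}(coord_basis (X := X) b_basis (memvf x)).
  rewrite (exchange_big_dep predT)//=; apply: eq_bigr => i _.
  rewrite (eq_bigl (pred1 (ev b`_i))); last by move=> d; rewrite /= eq_sym.
  rewrite -big_filter filter_pred1_uniq ?undup_uniq ?big_seq1//.
  by rewrite mem_undup map_f// mem_nth.
have Sw d : d \in r -> S (w d).
  by apply: (eigencomponents_stable S_lin SA) => //; [exact: undup_uniq|rewrite -xE].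
rewrite xE big_seq; elim/big_ind: _ => // d dr.
exact: (Peig d) (Sw d dr) (wE d).
Qed.

Variable t : {vspace a}.
Hypothesis t_cartan : cartan t.

Lemma cartan_lieC x y z : x \in t -> y \in t ->
  lie x (lie y z) = lie y (lie x z).
Proof.
move=> xt yt; have [t_ab _ _] := t_cartan.
have := lie_jacobi x y z.
rewrite (t_ab _ _ xt yt) linear0 addr0 [lie z x]lieC linearN /=.
by move/eqP; rewrite subr_eq0 => /eqP.
Qed.

(** The operators [ad x] for [x] in [xs] are diagonalized one at a time, by induction on [xs]. *)
Lemma common_eigen_ind (xs : seq a) (S P : a -> Prop) :
  {subset xs <= t} ->
  (forall c x y, S x -> S y -> S (c *: x + y)) ->
  (forall x y, x \in t -> S y -> S (lie x y)) ->
  P 0 -> (forall x y, P x -> P y -> P (x + y)) ->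
  (forall y, S y -> (forall x, x \in xs -> exists c, lie x y = c *: y) -> P y) ->
  forall y, S y -> P y.
Proof.
move=> + + + P0 PD; elim: xs S => [|x xs IH] S xst S_lin S_lie Peig y Sy.
  exact: Peig.
have xt : x \in t by apply: xst; rewrite mem_head.
have [_ _ /(_ x xt) x_diag] := t_cartan.
apply: (diagonalizable_eigen_ind x_diag S_lin _ P0 PD _ Sy) => [z Sz|c z Sz].
  by rewrite lfunE /=; apply: S_lie.
rewrite lfunE /= => xz.
(* The eigenspace of [ad x] in [S] is again stable under [t], because [t] is abelian. *)
apply: (IH (fun z => S z /\ lie x z = c *: z)) => //.
- by move=> e exs; apply: xst; rewrite inE exs orbT.
- move=> k y1 y2 [Sy1 xy1] [Sy2 xy2]; split; first exact: S_lin.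
  by rewrite lie_linearr xy1 xy2 scalerDr !scalerA mulrC.
- move=> e y1 et [Sy1 xy1]; split; first exact: S_lie.
  by rewrite cartan_lieC// xy1 linearZ.
- move=> y1 [Sy1 xy1] xsy1; apply: Peig => // e.
  by rewrite inE => /predU1P[->|/xsy1//]; exists c.
Qed.

Lemma common_eigen_root_vector (y : a) :
  (forall x, x \in (vbasis t : seq a) -> exists c, lie x y = c *: y) ->
  exists alpha : 'Hom(subvs_of t, K^o), root_vector alpha y.
Proof.
move=> /= ty.
have /choice[c cP] : forall x, exists c, x \in (vbasis t : seq a) -> lie x y = c *: y.
  move=> x; have [/ty[c]|_] := boolP (x \in (vbasis t : seq a)); first by exists c.
  by exists 0.
(* Extending from a basis makes [f] linear even for [y = 0], where the chosen eigenvalues are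
   arbitrary. *)
pose f (h : subvs_of t) : K^o :=
  \sum_(i < \dim t) coord (vbasis t) i (vsval h) * c (vbasis t)`_i.
have f_lin : linear f.
  move=> k h h'; rewrite /f scaler_sumr -big_split /=; apply: eq_bigr => i _.
  by rewrite !linearP /= mulrDl -mulrA.
pose F := GRing.isLinear.Build K (subvs_of t) K^o *:%R f f_lin.
pose fL : {linear subvs_of t -> K^o} := HB.pack f F.
exists (linfun fL) => h; rewrite lfunE /=.
rewrite {1}(coord_vbasis (subvsP h)) scaler_suml.
elim/big_rec2: _ => [|i u v _ IH]; first by rewrite lie0l.
rewrite lieDl IH lieZl cP ?mem_nth ?size_tuple//.
by rewrite scalerA.
Qed.

Lemma weight_ind (S P : a -> Prop) :
  (forall c x y, S x -> S y -> S (c *: x + y)) ->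
  (forall x y, x \in t -> S y -> S (lie x y)) ->
  P 0 -> (forall x y, P x -> P y -> P (x + y)) ->
  (forall (alpha : 'Hom(subvs_of t, K^o)) y, S y -> root_vector alpha y -> P y) ->
  forall y, S y -> P y.
Proof.
move=> S_lin S_lie P0 PD Pwt.
apply: (common_eigen_ind (xs := vbasis t)) => //.
  by move=> x; apply: vbasis_mem.
move=> y Sy /common_eigen_root_vector[alpha].
exact: Pwt.
Qed.

(** Adjoining [x] to [t] gives an abelian subspace, so maximality of [t] applies. *)
Lemma centralizer_cartan (x : a) :
  root_vector (0 : 'Hom(subvs_of t, K^o)) x -> x \in t.
Proof.
move=> tx; have [t_ab t_max _] := t_cartan.
have {}tx y : y \in t -> lie y x = 0.
  by move=> yt; have := tx (vsproj t y); rewrite vsprojK// lfunE scale0r.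
have <- : (t + <[x]>)%VS = t; last first.
  by rewrite -[x in x \in _]add0r memv_add ?mem0v ?memv_line.
apply: t_max (addvSl _ _).
move=> _ _ /memv_addP[y yt [_ /vlineP[c ->] ->]] /memv_addP[y' yt' [_ /vlineP[c' ->] ->]].
rewrite lieDl !linearD /= !linearZ /= !lieZl liexx (t_ab _ _ yt yt') (tx _ yt).
by rewrite lieC tx// oppr0 !scaler0 !addr0.
Qed.

End WeightDecomposition.

(** * Perfectness of simple Lie algebras *)

Section Simple.
Variables (K : fieldType) (a : finLieAlgType K).

(* The span of all brackets is a nonzero ideal. *)
Lemma simple_lie_ind (P : a -> Prop) : simple_lie a ->
  P 0 -> (forall x y, P x -> P y -> P (x + y)) -> (forall x y, P (lie x y)) ->
  forall x, P x.
Proof.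
move=> [[x0 [y0 xy0]] ideals] P0 PD Plie x.
pose e := vbasis {:a}.
pose I := <<[seq lie u v | u <- e, v <- e]>>%VS.
have lieI u v : lie u v \in I.
  rewrite (coord_vbasis (memvf v)) linear_sum memv_suml// => j _.
  rewrite linearZ /= memvZ// lieC memvN.
  rewrite (coord_vbasis (memvf u)) linear_sum memv_suml// => i _.
  rewrite linearZ /= memvZ//; apply: memv_span.
  by apply: allpairs_f; rewrite mem_nth ?size_tuple.
have [I0|IT] := ideals I (fun u v _ => lieI u v).
  by move: (lieI x0 y0); rewrite I0 memv0 (negPf xy0).
have : x \in I by rewrite IT memvf.
move=> /(@coord_span _ _ _ (in_tuple _)) ->.
elim/big_ind: _ => // i _.
have /allpairsP[[u v] /= [_ _ ->]] :
  (in_tuple [seq lie u v | u <- e, v <- e])`_i \in [seq lie u v | u <- e, v <- e].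
  by rewrite mem_nth.
(* The coefficient is absorbed into the bracket, since [P] is only known to be additive. *)
by rewrite -lieZl.
Qed.

End Simple.

(** * Additive generators of the affine algebra *)

Section Affine.
Variables (K : numFieldType) (a : finLieAlgType K) (t : {vspace a}).

Lemma loopDl (x y : a) f : loop t (x + y) f = loop t x f + loop t y f.
Proof.
by congr pair; rewrite /= ?addr0//; apply/laurentP => n /=; rewrite scalerDr.
Qed.

Lemma loop0l f : loop t 0 f = 0.
Proof. by congr pair; apply/laurentP => n /=; rewrite scaler0. Qed.

(** By finite dimension of [a], a Laurent series with values in [a] is a finite sum of pure
    tensors. *)
Lemma affine_ind (P : affine t -> Prop) :
  (forall x y, P x -> P y -> P (x + y)) ->
  (forall x f, P (loop t x f)) -> (forall c, P (c *: central t)) ->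
  forall x, P x.
Proof.
move=> PD Ploop Pc [x c].
have -> : (x, c) = ((x, 0) : affine t) + c *: central t.
  by congr pair; rewrite /= ?scaler0 ?addr0// add0r [RHS]mulr1.
apply: (PD) => //; elim/ltensor_ind: x => [X f|x y Px Py]; first exact: Ploop.
have -> : (x + y, 0) = ((x, 0) : affine t) + ((y, 0) : affine t).
  by congr pair; rewrite /= addr0.
exact: PD.
Qed.

End Affine.

(** * Extended maps on these generators *)

Section AffineMap.
Variables (K : numFieldType) (b a : finLieAlgType K).
Variables (s : {vspace b}) (t : {vspace a}) (u : {linear b -> a}) (l : K).

Lemma affine_mapD (x y : affine s) :
  affine_map t u l (x + y) = affine_map t u l x + affine_map t u l y.
Proof.
by congr pair; [apply/laurentP => n /=; rewrite linearD|rewrite /= mulrDl].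
Qed.

Lemma affine_map_loop x f : affine_map t u l (loop s x f) = loop t (u x) f.
Proof. by congr pair; [exact: lmap_tensor|rewrite /= mul0r]. Qed.

Lemma affine_map_central c :
  affine_map t u l (c *: central s) = (c * l) *: central t.
Proof.
congr pair; first by apply/laurentP => n /=; rewrite !scaler0 linear0.
by rewrite /= [c *: 1]mulr1 [RHS]mulr1.
Qed.

End AffineMap.

(** * Multi-shifts on vectors with partly prescribed weights *)

Section ShiftRestriction.
Variables (K : numFieldType) (a : finLieAlgType K) (t : {vspace a}).
Variables (n : nat) (z : 'I_n -> K) (nu : 'I_n -> a) (i : 'I_n).
Variable sigma : affine t -> affine t.
Hypothesis t_cartan : cartan t.
Hypothesis sigmaP : is_multi_shift z nu i sigma.

Lemma multi_shiftD x y : sigma (x + y) = sigma x + sigma y.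
Proof.
by have [[[sl _] _] _ _ _] := sigmaP; have := sl 1 x y; rewrite !scale1r.
Qed.

Lemma multi_shift0 : sigma 0 = 0.
Proof. by apply/(addrI (sigma 0)); rewrite -multi_shiftD !addr0. Qed.

Lemma multi_shift_centralZ c : sigma (c *: central t) = c *: central t.
Proof.
have [[[sl _] _] sc _ _] := sigmaP.
by have := sl c (central t) 0; rewrite multi_shift0 !addr0 sc.
Qed.

(* The weights of [y] under [t] are prescribed only on the family [w]; a nonzero
   prescribed eigenvalue forces all of them to be roots. *)
Lemma multi_shift_eigen (I : Type) (w : I -> a) (ev : I -> K) (j : 'I_n -> I)
    (k : 'I_n -> int) (y : a) (f : laurent K) :
  (forall x, w x \in t) -> (forall x, lie (w x) y = ev x *: y) ->
  (exists x, ev x != 0) ->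
  (forall s, w (j s) = nu s) -> (forall s, ev (j s) = (k s)%:~R) ->
  sigma (loop t y f) = loop t y (f * \prod_(s < n) shift_factor z i s ^ (- k s)).
Proof.
move=> wt wy [x0 evx0] wj evj.
pose S v := forall x, lie (w x) v = ev x *: v.
pose g := f * \prod_(s < n) shift_factor z i s ^ (- k s).
(* [S] is stable under [t], so [y] splits into weight vectors that all satisfy the same prescribed
   conditions. *)
apply: (weight_ind t_cartan (S := S)
  (P := fun v => sigma (loop t v f) = loop t v g)) => //.
- by move=> c v v' Sv Sv' x; rewrite lie_linearr Sv Sv' scalerDr !scalerA mulrC.
- by move=> x v xt Sv x'; rewrite (cartan_lieC t_cartan)// Sv linearZ.
- by rewrite !loop0l multi_shift0.
- by move=> v v' sv sv'; rewrite !loopDl multi_shiftD sv sv'.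
move=> beta v Sv beta_v.
have [->|v0] := eqVneq v 0; first by rewrite !loop0l multi_shift0.
(* A nonzero vector determines its eigenvalues, so [beta] agrees with [ev] on the family. *)
have betaE x : beta (vsproj t (w x)) = ev x.
  have := beta_v (vsproj t (w x)); rewrite vsprojK// Sv => /eqP.
  by rewrite -subr_eq0 -scalerBl scaler_eq0 (negPf v0) orbF subr_eq0 => /eqP.
apply: (multi_shift_root sigmaP f _ beta_v) => [|s]; last by rewrite -wj betaE.
split; last by exists v.
by apply: contraNneq evx0 => beta0; rewrite -betaE beta0 lfunE.
Qed.

End ShiftRestriction.

(** * The two restrictions: commutation and orthogonality *)

Section ProductMorphism.
Variables (K : fieldType) (L1 L2 M : lieAlgType K).
Variables (phi : {linear (L1 * L2)%type -> M}) (phi_lie : lie_morphism phi).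

Lemma restr1_lie x y : restr1 phi (lie x y) = lie (restr1 phi x) (restr1 phi y).
Proof.
case: phi_lie => _ philie; rewrite /restr1 -philie; congr (phi (_, _)).
by rewrite lie0l.
Qed.

Lemma restr2_lie x y : restr2 phi (lie x y) = lie (restr2 phi x) (restr2 phi y).
Proof.
case: phi_lie => _ philie; rewrite /restr2 -philie; congr (phi (_, _)).
by rewrite lie0l.
Qed.

Lemma restr_lie0 x y : lie (restr1 phi x) (restr2 phi y) = 0.
Proof.
case: phi_lie => _ philie; rewrite /restr1 /restr2 -philie.
rewrite -(linear0 phi); congr (phi (_, _)) => /=; first exact: lie0r.
exact: lie0l.
Qed.

End ProductMorphism.

(** On a bracket, invariance moves one factor next to [restr2 phi y], with which it commutes;
    brackets span [g1]. *)
Lemma nform_restr0 (K : numFieldType) (g1 g2 g : finLieAlgType K)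
    (phi : {linear (g1 * g2)%type -> g}) (t : {vspace g}) x y :
  simple_lie g1 -> lie_morphism phi ->
  nform t (restr2 phi y) (restr1 phi x) = 0.
Proof.
move=> g1_simple phi_lie; apply: (simple_lie_ind
  (P := fun x => nform t (restr2 phi y) (restr1 phi x) = 0) g1_simple).
- by rewrite linear0 nform0r.
- move=> u v IHu IHv; rewrite linearD /=.
  by have := nform_linearr t (restr2 phi y) 1 (restr1 phi u) (restr1 phi v);
     rewrite scale1r IHu IHv mulr0 addr0.
- by move=> u v; rewrite restr1_lie// -nform_lie lieC restr_lie0// oppr0 nform0l.
Qed.

(** * Comparison of the two compositions on each summand *)

Theorem theorem2 (R : realType) (g1 g2 g : finLieAlgType R[i])
  (g1_simple : simple_lie g1) (g2_simple : simple_lie g2)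
  (g_simple : simple_lie g)
  (phi : {linear (g1 * g2)%type -> g}) (phi_lie : lie_morphism phi)
  (h1 : {vspace g1}) (h2 : {vspace g2}) (h : {vspace g})
  (h1_cartan : cartan h1) (h2_cartan : cartan h2) (h_cartan : cartan h)
  (phi_h : forall x1 x2, x1 \in h1 -> x2 \in h2 -> phi (x1, x2) \in h)
  (l1 l2 : R[i])
  (l1_index : dynkin_index h1 h (restr1 phi) l1)
  (l2_index : dynkin_index h2 h (restr2 phi) l2)
  (n : nat) (z : 'I_n -> R[i]) (z_inj : injective z)
  (mu : 'I_n -> g1) (mu_coweight : forall i, coweight h1 (mu i))
  (mu_sum0 : \sum_(i < n) mu i = 0)
  (phi_mu_coweight : forall i, coweight h (restr1 phi (mu i)))
  (s : 'I_n)
  (sigma_mu : affine h1 -> affine h1)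
  (sigma_phi_mu : affine h -> affine h)
  (sigma_muP : is_multi_shift z mu s sigma_mu)
  (sigma_phi_muP :
     is_multi_shift z (fun i => restr1 phi (mu i)) s sigma_phi_mu) :
  sigma_phi_mu \o affine_map2 h phi l1 l2 =
  affine_map2 h phi l1 l2 \o
    (fun x : affine h1 * affine h2 => (sigma_mu x.1, x.2)).
Proof.
have restr1_h x : x \in h1 -> restr1 phi x \in h.
  by move=> xh; apply: phi_h; rewrite ?mem0v.
have restr2_h x : x \in h2 -> restr2 phi x \in h.
  by move=> xh; apply: phi_h; rewrite ?mem0v.
have mu_h i : mu i \in h1 by have [] := mu_coweight i.
have mu_phi_h i := restr1_h _ (mu_h i).
have sigmaD := multi_shiftD sigma_phi_muP.
have eigen_neq0 (V : finLieAlgType R[i]) (t : {vspace V})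
    (alpha : 'Hom(subvs_of t, R[i]^o)) : alpha != 0 -> exists x, alpha x != 0.
  move=> alpha0; apply: contrapT => /forallNP alpha_t.
  move/eqP: alpha0; apply; apply/lfunP => x; rewrite lfunE /=.
  exact/eqP/negPn/negP/alpha_t.
have sigma_restr1 x : sigma_phi_mu (affine_map h (restr1 phi) l1 x) =
    affine_map h (restr1 phi) l1 (sigma_mu x).
  elim/affine_ind: x => [x y IHx IHy|X f|c]; last first.
  - by rewrite (multi_shift_centralZ sigma_muP) affine_map_central
      (multi_shift_centralZ sigma_phi_muP).
  - pose P X := sigma_phi_mu (affine_map h (restr1 phi) l1 (loop h1 X f)) =
      affine_map h (restr1 phi) l1 (sigma_mu (loop h1 X f)).
    have P0 : P 0.
      rewrite /P affine_map_loop linear0 !loop0l (multi_shift0 sigma_phi_muP).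
      rewrite (multi_shift0 sigma_muP) -(loop0l h1 0) affine_map_loop linear0.
      by rewrite loop0l.
    apply: (weight_ind h1_cartan (S := fun=> True) (P := P)) => //.
      move=> x y IHx IHy.
      by rewrite /P loopDl affine_mapD sigmaD (multi_shiftD sigma_muP)
        affine_mapD IHx IHy.
    move=> alpha {}X _ alphaX; have [alpha0|alpha0] := eqVneq alpha 0.
      (* In weight zero [X] lies in [h1], and the Dynkin index matches the two central
         corrections. *)
      have Xh : X \in h1 by apply: (centralizer_cartan h1_cartan); rewrite -alpha0.
      rewrite /P (multi_shift_cartan sigma_muP)// affine_mapD affine_map_loop.
      rewrite affine_map_central (multi_shift_cartan sigma_phi_muP) ?restr1_h//.
      congr (_ + _ *: _); rewrite mulr_suml; apply: eq_bigr => i _.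
      by rewrite l1_index -mulrA mulrC.
    (* The zero vector is set aside because its weight [alpha] may fail to be a root. *)
    have [->//|X0] := eqVneq X 0.
    have alpha_root : is_root alpha by split=> //; exists X.
    have /choice[k kP] i := (mu_coweight i).2 alpha alpha_root.
    rewrite /P (multi_shift_root sigma_muP f alpha_root alphaX kP) !affine_map_loop.
    (* The image of [X] may mix several root spaces of [g]; only its eigenvalues under the image of
       [h1] are known, and that image contains every [restr1 phi (mu i)]. *)
    apply: (multi_shift_eigen (w := fun x : subvs_of h1 => restr1 phi (vsval x))
      (j := fun i => vsproj h1 (mu i)) h_cartan sigma_phi_muP _ _ _
      (eigen_neq0 _ _ _ alpha0) _ kP).
    + by move=> x; apply: restr1_h; apply: subvsP.
    + by move=> x; rewrite -restr1_lie// alphaX linearZ.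
    + by move=> i; rewrite vsprojK.
  - by rewrite affine_mapD sigmaD (multi_shiftD sigma_muP) affine_mapD IHx IHy.
have sigma_restr2 x : sigma_phi_mu (affine_map h (restr2 phi) l2 x) =
    affine_map h (restr2 phi) l2 x.
  elim/affine_ind: x => [x y IHx IHy|X f|c]; last first.
  - by rewrite affine_map_central (multi_shift_centralZ sigma_phi_muP).
  - pose P X := sigma_phi_mu (affine_map h (restr2 phi) l2 (loop h2 X f)) =
      affine_map h (restr2 phi) l2 (loop h2 X f).
    apply: (weight_ind h2_cartan (S := fun=> True) (P := P)) => //.
    + by rewrite /P affine_map_loop linear0 loop0l (multi_shift0 sigma_phi_muP).
    + by move=> x y IHx IHy; rewrite /P loopDl affine_mapD sigmaD IHx IHy.
    move=> alpha {}X _ alphaX; have [alpha0|alpha0] := eqVneq alpha 0.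
      (* In weight zero [X] lies in [h2], and orthogonality of the two images kills the
         correction. *)
      have Xh : X \in h2 by apply: (centralizer_cartan h2_cartan); rewrite -alpha0.
      rewrite /P affine_map_loop (multi_shift_cartan sigma_phi_muP) ?restr2_h//.
      rewrite big1 ?scale0r ?addr0// => i _.
      by rewrite nform_restr0// mul0r.
    rewrite /P !affine_map_loop.
    (* The image of [h2] supplies a nonzero eigenvalue, which forces the weights to be roots; the
       vectors [restr1 phi (mu i)] supply eigenvalue 0, so every exponent is 0. *)
    pose w (x : subvs_of h2 + 'I_n) :=
      match x with inl x => restr2 phi (vsval x) | inr i => restr1 phi (mu i) end.
    pose ev (x : subvs_of h2 + 'I_n) : R[i] := if x is inl x then alpha x else 0.
    rewrite (multi_shift_eigen (w := w) (ev := ev) (j := inr) (k := fun=> 0)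
      h_cartan sigma_phi_muP)//.
    + by rewrite big1 ?mulr1// => i _; rewrite oppr0 expr0z.
    + by case=> [x|i] /=; [apply: restr2_h; apply: subvsP|].
    + case=> [x|i] /=; last by rewrite restr_lie0// scale0r.
      by rewrite -restr2_lie// alphaX linearZ.
    + by have [x] := eigen_neq0 _ _ _ alpha0; exists (inl x).
  - by rewrite affine_mapD sigmaD IHx IHy.
by apply: funext => -[x1 x2]; rewrite /= /affine_map2 /= sigmaD sigma_restr1 sigma_restr2.
Qed.
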